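(* Let $R$ be a right non-singular ring and consider a commutative diagram of right $R$-modules and right $R$-module morphisms with $e$-exact rows $A_1 \xrightarrow{f_1} A_2 \xrightarrow{f_2} A_3 \xrightarrow{f_3} A_4$ and $B_1 \xrightarrow{g_1} B_2 \xrightarrow{g_2} B_3 \xrightarrow{g_3} B_4$ and vertical morphisms $t_i\colon A_i\to B_i$ ($i=1,2,3,4$), so that $t_{i+1}f_i=g_it_i$ for $i=1,2,3$. (1) If $t_1,t_3$ are $e$-epis, $t_4$ is monic and $B_2$ is non-singular, then $t_2$ is $e$-epi. (2) If $t_1$ is $e$-epi and $t_2,t_4$ are monic, then $\ker(t_3)$ is a singular module. In particular, if $A_3$ is a non-singular module, then $t_3$ is monic.
   Context: Rings are associative with identity $1\neq 0$, not necessarily commutative; modules are unitary right modules. A submodule $N\le M$ is essential in $M$ if $N\cap X\neq 0$ for every nonzero submodule $X$ of $M$. A cochain complex $\cdots\to M^{i-1}\xrightarrow{f^{i-1}}M^i\xrightarrow{f^i}M^{i+1}\to\cdots$ of right $R$-modules (so $f^if^{i-1}=0$) is $e$-exact if $f^{i-1}(M^{i-1})$ is an essential submodule of $\ker(f^i)$ for every $i$; for a finite row the condition is imposed at every term having both an incoming and an outgoing map in the row. A morphism $f\colon A\to B$ is $e$-epi if $f(A)$ is essential in $B$. For a right $R$-module $M$, the singular submodule is $Z(M)=\{x\in M \mid xI=0 \text{ for some essential right ideal } I \text{ of } R\}$; $M$ is singular if $Z(M)=M$ and non-singular if $Z(M)=0$. The ring $R$ is right non-singular if $Z(R_R)=0$.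 *)

(* Defs.v *)
From HB Require Import structures.
From mathcomp Require Import all_boot all_order all_algebra.
From mathcomp Require Import boolp classical_sets.

Set Implicit Arguments.
Unset Strict Implicit.
Unset Printing Implicit Defensive.

Import GRing.Theory.

Local Open Scope classical_set_scope.
Local Open Scope ring_scope.

(* Right R-modules are left modules over the converse ring R^c: for           *)
(* M : lmodType R^c, the right action "x r" is written r *: x. The right      *)
(* module R_R is R^c^o, where r *: x = x * r (product of R), so that the      *)
(* submodules of R^c^o are the right ideals of R.                             *)
(* A submodule N of M, regarded as a module in its own right, is represented  *)
(* by the set N; the module M itself is [set: M].                             *)

Section RightModules.
Variable R : nzRingType.
Implicit Types A B C M : lmodType R^c.

Definition is_submodule M (N : set M) : Prop := submod_closed [in N].

Definition ker A B (f : {linear A -> B}) : set A := f @^-1` [set 0].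

Definition essential_in M (N L : set M) : Prop :=
  [/\ is_submodule N, N `<=` L &
      forall X : set M, is_submodule X -> X `<=` L ->
        X <> [set 0] -> N `&` X <> [set 0]].

(* The inclusion of range f in ker g, i.e. g \o f = 0, is part of             *)
(* essential_in.                                                              *)
Definition e_exact_at A B C (f : {linear A -> B}) (g : {linear B -> C}) : Prop :=
  essential_in (range f) (ker g).

Definition e_epi A B (f : {linear A -> B}) : Prop :=
  essential_in (range f) [set: B].

Definition essential_right_ideal (I : set R^c^o) : Prop :=
  essential_in I [set: R^c^o].

Definition singular_part M (N : set M) : set M :=
  [set x | N x /\ exists I : set R^c^o,
     essential_right_ideal I /\ forall r : R^c, I r -> r *: x = 0].

Definition singular M (N : set M) : Prop := singular_part N = N.

Definition nonsingular M (N : set M) : Prop := singular_part N = [set 0].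

End RightModules.

Definition right_nonsingular_ring (R : nzRingType) : Prop :=
  nonsingular [set: R^c^o].

(* Main.v *)
(* Over a right non-singular ring, if [N] is essential in [L] then a finite   *)
(* number of elements of [L] can be pushed into [N] by a multiplier that does *)
(* not kill a prescribed nonzero [s] in [R]. So the diagram chases of the     *)
(* four lemma go through after multiplying, step by step, by scalars keeping  *)
(* the total multiplier nonzero, and an element [x] is singular exactly when  *)
(* every nonzero [s] has a multiple [s r] <> 0 with [x (s r)] = 0.            *)

Require Import Defs.
From HB Require Import structures.
From mathcomp Require Import all_boot all_order all_algebra.
From mathcomp Require Import boolp classical_sets.

Set Implicit Arguments.
Unset Strict Implicit.
Unset Printing Implicit Defensive.

Import GRing.Theory.

Local Open Scope classical_set_scope.
Local Open Scope ring_scope.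

Section EssentialSubmodules.
Variable R : nzRingType.
Implicit Types M A B C : lmodType R^c.

(** The usual chase lifts elements through exact rows and epimorphisms; here each such lift exists
    only after multiplying by a scalar ([essential_multiplier]), and these scalars pile up in front
    of the starting one [s]. In part (1), non-singularity of [B2] ([nonsingularP]) gives an [s] for
    which a nonzero total multiplier keeps the element of [B2] nonzero, so its multiple in
    [range t2] witnesses essentiality. In part (2), the chase ends with a nonzero multiple of an
    arbitrary [s] killing the element of [ker t3], which is singularity by [singular_partP]. *)

Lemma is_submoduleP M (N : set M) :
  is_submodule N <-> N 0 /\ forall (r : R^c) x y, N x -> N y -> N (r *: x + y).
Proof.
split=> [[N0 Nlin]|[N0 Nlin]].
  by split=> [|r x y Nx Ny]; apply: set_mem; [|apply: Nlin; exact: mem_set].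
by split=> [|r x y /set_mem Nx /set_mem Ny]; apply: mem_set; [|exact: Nlin].
Qed.

Lemma submodule_scale M (N : set M) (r : R^c) x :
  is_submodule N -> N x -> N (r *: x).
Proof.
by move=> /is_submoduleP[N0 Nlin] Nx; rewrite -[_ *: _]addr0; exact: Nlin.
Qed.

Lemma submoduleT M : is_submodule [set: M].
Proof. exact/is_submoduleP. Qed.

Lemma submodule_ker A B (f : {linear A -> B}) : is_submodule (ker f).
Proof.
apply/is_submoduleP; split=> [|r x y]; rewrite /ker /= ?linear0 //.
by move=> fx fy; rewrite linearP fx fy scaler0 addr0.
Qed.

Lemma submodule_range A B (f : {linear A -> B}) : is_submodule (range f).
Proof.
apply/is_submoduleP; split=> [|r _ _ [a _ <-] [b _ <-]].
  by exists 0; rewrite ?linear0.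
by exists (r *: a + b); rewrite ?linearP.
Qed.

Lemma submodule_line M (x : M) : is_submodule (range (fun r : R^c => r *: x)).
Proof.
apply/is_submoduleP; split=> [|r _ _ [a _ <-] [b _ <-]].
  by exists 0; rewrite ?scale0r.
by exists (r * a + b); rewrite ?scalerDl ?scalerA.
Qed.

Lemma submodule_eq0 M (N : set M) :
  is_submodule N -> N = [set 0] <-> forall x, N x -> x = 0.
Proof.
move=> /is_submoduleP[N0 _]; split=> [-> //|N_0].
by apply/seteqP; split=> [x /N_0|_ ->].
Qed.

(** Every nonzero submodule contains a nonzero cyclic one, so only these need testing. *)
Lemma essential_inP M (N L : set M) : is_submodule L ->
  essential_in N L <->
  [/\ is_submodule N, N `<=` L &
      forall x, L x -> x != 0 -> exists2 r : R^c, r *: x != 0 & N (r *: x)].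
Proof.
move=> subL; split=> -[subN NL essN]; split=> //.
  move=> x Lx x0.
  apply: contrapT => nex.
  have xX : range (fun r : R^c => r *: x) x by exists 1; rewrite ?scale1r.
  apply: (essN _ (submodule_line x)).
  - by move=> _ [r _ <-]; exact: submodule_scale.
  - by move=> X0; rewrite X0 in xX; case/eqP: x0.
  apply/seteqP; split=> [z [Nz [r _ rx]]|_ ->].
    rewrite -{z}rx /= in Nz *; apply: contrapT => /eqP rx0.
    by apply: nex; exists r.
  split; last by exists 0; rewrite ?scale0r.
  by have [] := (is_submoduleP N).1 subN.
move=> X subX XL X0 NX0; apply: X0; apply/(submodule_eq0 subX) => x Xx.
apply: contrapT => /eqP x0; have [r rx0 Nrx] := essN x (XL x Xx) x0.
have : (N `&` X) (r *: x) by split=> //; exact: submodule_scale.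
by rewrite NX0 /= => /eqP; exact/negP.
Qed.

(* Products below are taken in [R^c]: [r * s] is the product [s r] of [R]. *)
Lemma essential_right_idealP (I : set R^c^o) :
  essential_right_ideal I <->
  is_submodule I /\
  forall s : R^c, s != 0 -> exists2 r : R^c, r * s != 0 & I (r * s).
Proof.
split=> [/(essential_inP _ (submoduleT _))[subI _ essI]|[subI essI]].
  by split=> // s; exact: essI.
by apply/(essential_inP _ (submoduleT _)); split=> // s _; exact: essI.
Qed.

(** The annihilator of [x] is the largest candidate for [I], so only its essentiality matters. *)
Lemma singular_partP M (N : set M) x :
  singular_part N x <->
  N x /\ forall s : R^c, s != 0 ->
    exists2 r : R^c, r * s != 0 & r *: (s *: x) = 0.
Proof.
split=> [[Nx [I [/essential_right_idealP[_ essI] Ix]]]|[Nx annx]].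
  split=> // s /essI[r rs0 Irs]; exists r => //.
  by rewrite scalerA; exact: Ix.
split=> //; exists [set r : R^c | r *: x = 0]; split=> //.
apply/essential_right_idealP; split=> [|s /annx[r rs0 rsx]].
  apply/is_submoduleP; split=> [|r a b /= ax bx]; first exact: scale0r.
  by rewrite scalerDl -scalerA ax bx scaler0 addr0.
by exists r; rewrite //= -scalerA.
Qed.

Lemma nonsingularP M (x : M) : nonsingular [set: M] -> x != 0 ->
  exists2 s : R^c, s != 0 &
    forall r : R^c, r * s != 0 -> r *: (s *: x) != 0.
Proof.
move=> nsM x0; apply: contrapT => nex.
suff : singular_part [set: M] x by rewrite nsM => /eqP; exact/negP.
apply/singular_partP; split=> // s s0; apply: contrapT => nexr.
apply: nex; exists s => // r rs0; apply/eqP => rsx.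
by apply: nexr; exists r.
Qed.

(** The scalars sending [x] into [N] form an essential right ideal. If it annihilated [s], then [s]
    would be a nonzero singular element of the ring. *)
Lemma essential_multiplier M (N L : set M) (x : M) (s : R^c) :
  right_nonsingular_ring R -> is_submodule L -> essential_in N L ->
  L x -> s != 0 -> exists2 r : R^c, r * s != 0 & N (r *: x).
Proof.
move=> nsR subL /(essential_inP _ subL)[subN _ essN] Lx s0.
have [N0 Nlin] := (is_submoduleP N).1 subN.
have essI : essential_right_ideal [set r : R^c | N (r *: x)].
  apply/essential_right_idealP; split=> [|u u0].
    apply/is_submoduleP; split=> [|r a b /= ax bx]; first by rewrite /= scale0r.
    by rewrite scalerDl -scalerA; exact: Nlin.
  have [ux0|ux0] := eqVneq (u *: x) 0.
    by exists 1; rewrite /= mul1r // ux0.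
  have [r rux0 Nrux] := essN _ (submodule_scale u subL Lx) ux0.
  exists r; rewrite /= -?scalerA //.
  by apply: contraNneq rux0 => ru0; rewrite scalerA ru0 scale0r.
apply: contrapT => nex.
suff : singular_part [set: R^c^o] s by rewrite nsR => /eqP; exact/negP.
split=> //; exists [set r : R^c | N (r *: x)]; split=> // r Nrx.
by apply: contrapT => /eqP rs0; apply: nex; exists r.
Qed.

Lemma e_exact_at_comp0 A B C (f : {linear A -> B}) (g : {linear B -> C}) a :
  e_exact_at f g -> g (f a) = 0.
Proof. by case=> _ fg _; apply: fg; exists a. Qed.

Lemma e_exact_at_multiplier A B C (f : {linear A -> B}) (g : {linear B -> C})
    (b : B) (s : R^c) :
  right_nonsingular_ring R -> e_exact_at f g -> g b = 0 -> s != 0 ->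
  exists (r : R^c) (a : A), r * s != 0 /\ f a = r *: b.
Proof.
move=> nsR fg gb s0.
have [r rs0 [a _ fa]] :=
  essential_multiplier nsR (submodule_ker g) fg gb s0.
by exists r, a.
Qed.

Lemma e_epi_multiplier A B (f : {linear A -> B}) (b : B) (s : R^c) :
  right_nonsingular_ring R -> e_epi f -> s != 0 ->
  exists (r : R^c) (a : A), r * s != 0 /\ f a = r *: b.
Proof.
move=> nsR ef s0.
have [//|r rs0 [a _ fa]] :=
  essential_multiplier (x := b) nsR (submoduleT B) ef _ s0.
by exists r, a.
Qed.

End EssentialSubmodules.

Theorem proposition3p1 (R : nzRingType)
  (A1 A2 A3 A4 B1 B2 B3 B4 : lmodType R^c)
  (f1 : {linear A1 -> A2}) (f2 : {linear A2 -> A3}) (f3 : {linear A3 -> A4})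
  (g1 : {linear B1 -> B2}) (g2 : {linear B2 -> B3}) (g3 : {linear B3 -> B4})
  (t1 : {linear A1 -> B1}) (t2 : {linear A2 -> B2})
  (t3 : {linear A3 -> B3}) (t4 : {linear A4 -> B4})
  (hR : right_nonsingular_ring R)
  (hA2 : e_exact_at f1 f2) (hA3 : e_exact_at f2 f3)
  (hB2 : e_exact_at g1 g2) (hB3 : e_exact_at g2 g3)
  (comm1 : t2 \o f1 =1 g1 \o t1)
  (comm2 : t3 \o f2 =1 g2 \o t2)
  (comm3 : t4 \o f3 =1 g3 \o t3) :
  (e_epi t1 -> e_epi t3 -> injective t4 -> nonsingular [set: B2] -> e_epi t2)
  /\
  (e_epi t1 -> injective t2 -> injective t4 ->
     singular (ker t3) /\ (nonsingular [set: A3] -> injective t3)).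
Proof.
have monic4 : injective t4 -> forall a, g3 (t3 a) = 0 -> f3 a = 0.
  move=> inj4 a g3t3a; apply: inj4.
  by rewrite linear0 -g3t3a; exact: comm3.
split=> [epi1 epi3 inj4 nsB2|epi1 inj2 inj4].
  apply/(essential_inP _ (@submoduleT _ B2)).
  split=> [||y _ y0]; [exact: submodule_range|by []|].
  have [s s0 sy] := nonsingularP nsB2 y0.
  have [r [a3 [rs0 t3a3]]] := e_epi_multiplier (g2 (s *: y)) hR epi3 s0.
  have f3a3 : f3 a3 = 0.
    apply: monic4 => //.
    by rewrite t3a3 linearZ /= (e_exact_at_comp0 _ hB3) scaler0.
  have [r' [a2 [rs0' f2a2]]] := e_exact_at_multiplier hR hA3 f3a3 rs0.
  (* The lift [a2] matches the multiple of [y] only up to [ker g2]; this error is pulled back along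
     [g1] and then [t1]. *)
  have g2d : g2 (r' *: (r *: (s *: y)) - t2 a2) = 0.
    apply/eqP; rewrite linearB subr_eq0 -[g2 (t2 a2)]comm2 /= f2a2.
    by rewrite !linearZ /= t3a3 !linearZ.
  have [r2 [b1 [rs2 g1b1]]] := e_exact_at_multiplier hR hB2 g2d rs0'.
  have [r1 [a1 [rs1 t1a1]]] := e_epi_multiplier b1 hR epi1 rs2.
  (* The product of all multipliers is nonzero, so [sy] applies; [f1 a1] corrects the error of
     [a2]. *)
  exists (r1 * (r2 * (r' * r)) * s).
    by rewrite -scalerA; apply: sy; rewrite -!mulrA.
  exists (f1 a1 + r1 *: (r2 *: a2)) => //.
  rewrite linearD [t2 (f1 a1)]comm1 /= t1a1 !linearZ /= g1b1.
  by rewrite -scalerDr -scalerDr subrK !scalerA !mulrA.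
have sing_ker : singular (ker t3).
  apply/seteqP; split=> [a3 []//|a3 t3a3].
  apply/singular_partP; split=> // s s0.
  have f3a3 : f3 a3 = 0 by apply: monic4 => //; rewrite t3a3 linear0.
  have f3sa3 : f3 (s *: a3) = 0 by rewrite linearZ /= f3a3 scaler0.
  have [r [a2 [rs0 f2a2]]] := e_exact_at_multiplier hR hA3 f3sa3 s0.
  have g2t2a2 : g2 (t2 a2) = 0.
    by rewrite -[g2 _]comm2 /= f2a2 !linearZ /= t3a3 !scaler0.
  have [r2 [b1 [rs2 g1b1]]] := e_exact_at_multiplier hR hB2 g2t2a2 rs0.
  have [r1 [a1 [rs1 t1a1]]] := e_epi_multiplier b1 hR epi1 rs2.
  (* A multiple of [a2] comes from [A1], so [f2] kills it, and with it a multiple of [s *: a3]. *)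
  have f1a1 : f1 a1 = r1 *: (r2 *: a2).
    by apply: inj2; rewrite [LHS]comm1 /= t1a1 !linearZ /= g1b1.
  exists (r1 * (r2 * r)); first by rewrite -!mulrA.
  have := e_exact_at_comp0 a1 hA2.
  by rewrite f1a1 !linearZ /= f2a2 !scalerA !mulrA.
split=> // nsA3 a b t3ab; apply/eqP; rewrite -subr_eq0; apply/eqP.
have : ker t3 (a - b) by rewrite /ker /= linearB t3ab subrr.
(* The annihilating ideal does not depend on the ambient submodule, so [a - b] is singular in [A3]
   too. *)
rewrite -sing_ker => -[_ sing_ab].
by have : singular_part [set: A3] (a - b); [split|rewrite nsA3].
Qed.
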